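(* Let $R$ be a commutative unitary ring, $E$ the free $R$-module generated by $e_1,\dots,e_n$, $f\in E^\vee=\operatorname{Hom}_R(E,R)$, and let $K^*$ be the Koszul complex of $f_1=f(e_1),\dots,f_n=f(e_n)$, that is, $K^{-i}=\bigwedge^iE$ with differential the contraction operator $\boldsymbol{i}_f$. Let $K^{<0}$ be the truncation of $K^*$ in degrees $<0$. If the Koszul complex $K^*$ is exact, then the morphism of DG-Lie algebras $$\boldsymbol{i}^{<0}\colon{\bigwedge}^*E^\vee\to\operatorname{Hom}^*_R(K^{<0},K^{<0})$$ is surjective in cohomology, and then $\operatorname{Hom}^*_R(K^{<0},K^{<0})$ is numerically homotopy abelian.
   Context: **Contractions.** The internal product $\lrcorner\colon\bigwedge^*E^\vee\times\bigwedge^*E\to\bigwedge^*E$ is the $R$-bilinear map defined recursively by $g\lrcorner(v_1\wedge\cdots\wedge v_b)=\sum_{i=1}^b(-1)^{i-1}g(v_i)\,v_1\wedge\cdots\wedge\widehat{v_i}\wedge\cdots\wedge v_b$ for $g\in E^\vee$, and $(g_1\wedge\cdots\wedge g_a)\lrcorner\omega=(g_1\wedge\cdots\wedge g_{a-1})\lrcorner(g_a\lrcorner\omega)$. For $\psi\in\bigwedge^*E^\vee$, $\boldsymbol{i}_\psi(\omega)=\psi\lrcorner\omega$. $\bigwedge^*E^\vee$ is regarded as a differential graded commutative algebra with trivial differential and $\bigwedge^iE^\vee$ in degree $i$; as a DG-Lie algebra (graded commutator) it is abelian with zero differential. The Koszul complex is $K^*\colon0\to K^{-n}\xrightarrow{\boldsymbol{i}_f}\cdots\to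 K^{-1}\xrightarrow{\boldsymbol{i}_f}K^0=R$. ''$K^*$ is exact'' means $H^j(K^* )=0$ for every $j\ne0$ (e.g. when $f_1,\dots,f_n$ is a regular sequence). The truncation is $K^{<0}\colon0\to K^{-n}\xrightarrow{\boldsymbol{i}_f}\cdots\xrightarrow{\boldsymbol{i}_f}K^{-1}$. Let $j\colon K^{<0}\to K^*$ be the (graded) inclusion and $\pi\colon K^*\to K^{<0}$ the projection; then $\boldsymbol{i}^{<0}_\psi=\pi\boldsymbol{i}_\psi j$. $\operatorname{Hom}^*_R(K^{<0},K^{<0})$ is the DG-Lie algebra of graded $R$-linear endomorphisms, with the graded commutator as bracket and with differential the graded commutator with the differential of $K^{<0}$. **DG-Lie algebras over $R$.** A DG-Lie algebra over $R$ is a cochain complex $(L,d)$ of $R$-modules with an $R$-bilinear bracket such that, for homogeneous elements: $[L^i,L^j]\subset L^{i+j}$; $[a,b]+(-1)^{\bar a\bar b}[b,a]=0$; $[a,a]=0$ for $a$ of even degree; $d[a,b]=[da,b]+(-1)^{\bar a}[a,db]$; $[a,[b,c]]=[[a,b],c]+(-1)^{\bar a\bar b}[b,[a,c]]$; $[b,[b,b]]=0$ for $b$ of odd degree. It is abelian if the bracket is zero. A DG-Lie algebra $L$ over $R$ is numerically homotopy abelian if there is a finite zigzag of morphisms of DG-Lie algebras over $R$, $L\xleftarrow{f_1}L_1\xrightarrow{g_1}L_2\xleftarrow{f_3}L_3\xrightarrow{g_3}\cdots\xleftarrow{f_m}L_m\xrightarrow{g_m}M$, with $M$ abelian, every $f_i$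 surjective in cohomology and every $g_i$ injective in cohomology. *)

(* Defs.v *)
From HB Require Import structures.
From mathcomp Require Import all_boot all_order all_algebra.
From mathcomp Require Import boolp ssrAC zify ring.

Set Implicit Arguments.
Unset Strict Implicit.
Unset Printing Implicit Defensive.

Import Order.TTheory GRing.Theory Num.Theory.
Local Open Scope ring_scope.

(* (-1)^i for an integer i *)
Definition ksgn (R : pzRingType) (i : int) : R := (-1) ^+ absz i.
Arguments ksgn : clear implicits.

Lemma ksgn_odd (R : pzRingType) i j : odd `|i| = odd `|j| -> ksgn R i = ksgn R j.
Proof. by move=> e; rewrite /ksgn -signr_odd e signr_odd. Qed.

Lemma ksgnD (R : pzRingType) i j : ksgn R (i + j) = ksgn R i * ksgn R j.
Proof.
rewrite /ksgn -exprD -signr_odd -[in RHS]signr_odd; congr (_ ^+ nat_of_bool _).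
lia.
Qed.

Lemma ksgn_sq (R : pzRingType) i : ksgn R i * ksgn R i = 1.
Proof. by rewrite -expr2 sqrr_sign. Qed.

(* Degrees are carried by equations such as i + 1 = j, so that no transport is
   needed between, e.g., L (i + j) and L (j + i); int has decidable equality,
   so nothing depends on the choice of these proofs. *)

Section Complexes.
Variable R : comPzRingType.

Record complex := Complex {
  cx_mod :> int -> lmodType R;
  cx_d : forall i j, i + 1 = j -> {linear cx_mod i -> cx_mod j};
  cx_dd : forall i j k (ij : i + 1 = j) (jk : j + 1 = k) x,
    cx_d jk (cx_d ij x) = 0 }.

Definition cocycle (C : complex) i (x : C i) : Prop :=
  cx_d C (erefl (i + 1)) x = 0.

Definition coboundary (C : complex) j (x : C j) : Prop :=
  exists i (e : i + 1 = j) (y : C i), x = cx_d C e y.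

Definition exact_nonzero_degrees (C : complex) : Prop :=
  forall j : int, j != 0 -> forall x : C j, cocycle x -> coboundary x.

(* Graded maps of degree k: Hom^k(C, D) = \prod_i Hom_R(C^i, D^(i+k)). *)
Record hom (C D : complex) (k : int) := Hom {
  hom_app :> forall i j, i + k = j -> C i -> D j;
  hom_lin : forall i j (e : i + k = j), linear (hom_app e) }.

Section HomModule.
Variables (C D : complex) (k : int).
Implicit Types u v w : hom C D k.

Lemma homP u v : (forall i j (e : i + k = j) x, u i j e x = v i j e x) -> u = v.
Proof.
case: u v => [u lu] [v lv] /= uv.
have {}uv : u = v.
  apply: functional_extensionality_dep => i.
  apply: functional_extensionality_dep => j.
  apply: functional_extensionality_dep => e.
  by apply: funext => x.
by subst v; congr Hom; exact: Prop_irrelevance.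
Qed.

HB.instance Definition _ := gen_eqMixin (hom C D k).
HB.instance Definition _ := gen_choiceMixin (hom C D k).

Fact hom_zero_lin i j (_ : i + k = j) : linear (fun _ : C i => 0 : D j).
Proof. by move=> a x y; rewrite scaler0 addr0. Qed.

Fact hom_opp_lin u i j (e : i + k = j) : linear (fun x => - u i j e x).
Proof. by move=> a x y; rewrite hom_lin opprD scalerN. Qed.

Fact hom_add_lin u v i j (e : i + k = j) :
  linear (fun x => u i j e x + v i j e x).
Proof. by move=> a x y; rewrite !hom_lin scalerDr addrACA. Qed.

Fact hom_scale_lin (c : R) u i j (e : i + k = j) :
  linear (fun x => c *: u i j e x).
Proof. by move=> a x y; rewrite hom_lin scalerDr !scalerA mulrC. Qed.

Definition hom_zero : hom C D k := Hom hom_zero_lin.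
Definition hom_opp u : hom C D k := Hom (hom_opp_lin u).
Definition hom_add u v : hom C D k := Hom (hom_add_lin u v).
Definition hom_scale c u : hom C D k := Hom (hom_scale_lin c u).

Fact hom_addA : associative hom_add.
Proof. by move=> u v w; apply: homP => i j e x /=; rewrite addrA. Qed.
Fact hom_addC : commutative hom_add.
Proof. by move=> u v; apply: homP => i j e x /=; rewrite addrC. Qed.
Fact hom_add0 : left_id hom_zero hom_add.
Proof. by move=> u; apply: homP => i j e x /=; rewrite add0r. Qed.
Fact hom_addN : left_inverse hom_zero hom_opp hom_add.
Proof. by move=> u; apply: homP => i j e x /=; rewrite addNr. Qed.

HB.instance Definition _ := GRing.isZmodule.Build (hom C D k)
  hom_addA hom_addC hom_add0 hom_addN.

Fact hom_scaleA a b u : hom_scale a (hom_scale b u) = hom_scale (a * b) u.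
Proof. by apply: homP => i j e x /=; rewrite scalerA. Qed.
Fact hom_scale1 : left_id 1 hom_scale.
Proof. by move=> u; apply: homP => i j e x /=; rewrite scale1r. Qed.
Fact hom_scaleDr : right_distributive hom_scale +%R.
Proof. by move=> c u v; apply: homP => i j e x /=; rewrite scalerDr. Qed.
Fact hom_scaleDl u : {morph hom_scale^~ u : a b / a + b}.
Proof. by move=> a b; apply: homP => i j e x /=; rewrite scalerDl. Qed.

HB.instance Definition _ := GRing.Zmodule_isLmodule.Build R (hom C D k)
  hom_scaleA hom_scale1 hom_scaleDr hom_scaleDl.

End HomModule.

Section HomEval.
Variables (C D : complex) (k i j : int) (e : i + k = j) (u : hom C D k).

HB.instance Definition _ := GRing.isLinear.Build R (C i) (D j) *:%R
  (u i j e) (hom_lin u e).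

End HomEval.

Section HomEvalE.
Variables (C D : complex) (k i j : int) (e : i + k = j).
Implicit Types (u v : hom C D k) (x : C i).

Lemma hom_addE u v x : (u + v) i j e x = u i j e x + v i j e x.
Proof. by []. Qed.
Lemma hom_oppE u x : (- u) i j e x = - u i j e x. Proof. by []. Qed.
Lemma hom_scaleE c u x : (c *: u) i j e x = c *: u i j e x. Proof. by []. Qed.
Lemma hom_zeroE x : (0 : hom C D k) i j e x = 0. Proof. by []. Qed.
Definition homE := (hom_addE, hom_oppE, hom_scaleE, hom_zeroE).
End HomEvalE.

(* brk_skew, brk_even, brk_leibniz, brk_jacobi, brk_odd are the axioms
   [a,b] + (-1)^(ij)[b,a] = 0; [a,a] = 0 in even degree; graded Leibniz;
   [a,[b,c]] = [[a,b],c] + (-1)^(ij)[b,[a,c]]; [b,[b,b]] = 0 in odd degree. *)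
Record dgla := Dgla {
  dg_cx :> complex;
  brk : forall i j k, i + j = k -> dg_cx i -> dg_cx j -> dg_cx k;
  brk_linl : forall i j k (e : i + j = k) b, linear (fun a => brk e a b);
  brk_linr : forall i j k (e : i + j = k) a, linear (fun b => brk e a b);
  brk_skew : forall i j k (ij : i + j = k) (ji : j + i = k) a b,
    brk ij a b + ksgn R (i * j) *: brk ji b a = 0;
  brk_even : forall i k (ii : i + i = k) a, ~~ odd `|i| -> brk ii a a = 0;
  brk_leibniz : forall i j k i' j' k' (ij : i + j = k) (kk' : k + 1 = k')
      (ii' : i + 1 = i') (jj' : j + 1 = j')
      (i'j : i' + j = k') (ij' : i + j' = k') a b,
    cx_d dg_cx kk' (brk ij a b)
    = brk i'j (cx_d dg_cx ii' a) b + ksgn R i *: brk ij' a (cx_d dg_cx jj' b);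
  brk_jacobi : forall i j k ij jk ik ijk (eij : i + j = ij) (ejk : j + k = jk)
      (eik : i + k = ik) (ei_jk : i + jk = ijk) (eij_k : ij + k = ijk)
      (ej_ik : j + ik = ijk) a b c,
    brk ei_jk a (brk ejk b c)
    = brk eij_k (brk eij a b) c + ksgn R (i * j) *: brk ej_ik b (brk eik a c);
  brk_odd : forall i j k (ii : i + i = j) (ij : i + j = k) b,
    odd `|i| -> brk ij b (brk ii b b) = 0 }.

Definition abelian_dgla (L : dgla) : Prop :=
  forall i j k (e : i + j = k) (a : L i) (b : L j), brk e a b = 0.

Record dgla_mor (L M : dgla) := DglaMor {
  mor_app :> forall i, {linear L i -> M i};
  mor_d : forall i j (e : i + 1 = j) a,
    mor_app j (cx_d L e a) = cx_d M e (mor_app i a);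
  mor_brk : forall i j k (e : i + j = k) a b,
    mor_app k (brk e a b) = brk e (mor_app i a) (mor_app j b) }.

(* Every class of H^i(M) is the image of a class of H^i(L). *)
Definition surjective_in_cohomology L M (f : dgla_mor L M) : Prop :=
  forall i (y : M i), cocycle y ->
  exists x : L i, cocycle x /\ coboundary (f i x - y).

(* H^i(f) has trivial kernel. *)
Definition injective_in_cohomology L M (f : dgla_mor L M) : Prop :=
  forall i (x : L i), cocycle x -> coboundary (f i x) -> coboundary x.

(* L <-f- L1 -g-> L2 <- ... -> M with M abelian, one pair (f, g) per step. *)
Inductive numerically_homotopy_abelian : dgla -> Prop :=
| nha_abelian M : abelian_dgla M -> numerically_homotopy_abelian M
| nha_zigzag L L1 L2 (f : dgla_mor L1 L) (g : dgla_mor L1 L2) :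
    surjective_in_cohomology f -> injective_in_cohomology g ->
    numerically_homotopy_abelian L2 -> numerically_homotopy_abelian L.

Section EndoDgla.
Variable C : complex.

Fact comp_deg1 (k l m i j : int) : k + l = m -> i + m = j -> i + l + k = j.
Proof. lia. Qed.

Fact addC_deg (k l m : int) : k + l = m -> l + k = m.
Proof. by rewrite addrC. Qed.

Fact hom_comp_lin k l m (h : k + l = m) (u : hom C C k) (v : hom C C l)
    i j (e : i + m = j) :
  linear (fun x => u (i + l) j (comp_deg1 h e) (v i (i + l) erefl x)).
Proof. by move=> a x y; rewrite !linearP. Qed.

Definition hom_comp k l m (h : k + l = m) (u : hom C C k) (v : hom C C l) :
  hom C C m := Hom (hom_comp_lin h u v).

Lemma hom_compE k l m (h : k + l = m) u v i j (e : i + m = j) p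
    (e1 : i + l = p) (e2 : p + k = j) x :
  hom_comp h u v i j e x = u p j e2 (v i p e1 x).
Proof. by subst p => /=; rewrite (eq_irrelevance (comp_deg1 h e) e2). Qed.

(* graded commutator [u, v] = u v - (-1)^(kl) v u *)
Definition comm k l m (h : k + l = m) (u : hom C C k) (v : hom C C l) :
    hom C C m :=
  hom_comp h u v - ksgn R (k * l) *: hom_comp (addC_deg h) v u.

Lemma commE k l m (h : k + l = m) u v i j (e : i + m = j) p q
    (e1 : i + l = p) (e2 : p + k = j) (e3 : i + k = q) (e4 : q + l = j) x :
  comm h u v i j e x
  = u p j e2 (v i p e1 x) - ksgn R (k * l) *: v q j e4 (u i q e3 x).
Proof.
by rewrite !homE (hom_compE _ _ _ _ e1 e2) (hom_compE _ _ _ _ e3 e4).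
Qed.

Lemma comm_linl k l m (h : k + l = m) v : linear (fun u => comm h u v).
Proof.
move=> a u w; apply: homP => i j e x.
have e3 := erefl (i + k); have e4 : i + k + l = j by lia.
have e1 := erefl (i + l); have e2 : i + l + k = j by lia.
rewrite [in RHS]hom_addE [in RHS]hom_scaleE !(commE _ _ _ _ e1 e2 e3 e4) !homE linearP.
by rewrite !scalerBr scalerDr !scalerA opprD (mulrC a) addrACA.
Qed.

Lemma comm_linr k l m (h : k + l = m) u : linear (fun v => comm h u v).
Proof.
move=> a v w; apply: homP => i j e x.
have e3 := erefl (i + k); have e4 : i + k + l = j by lia.
have e1 := erefl (i + l); have e2 : i + l + k = j by lia.
rewrite [in RHS]hom_addE [in RHS]hom_scaleE !(commE _ _ _ _ e1 e2 e3 e4) !homE linearP.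
by rewrite !scalerBr scalerDr !scalerA opprD (mulrC a) addrACA.
Qed.

Lemma comm_skew k l m (kl : k + l = m) (lk : l + k = m) u v :
  comm kl u v + ksgn R (k * l) *: comm lk v u = 0.
Proof.
apply: homP => i j e x.
have e3 := erefl (i + k); have e4 : i + k + l = j by lia.
have e1 := erefl (i + l); have e2 : i + l + k = j by lia.
rewrite [LHS]hom_addE hom_scaleE (commE _ _ _ _ e1 e2 e3 e4).
rewrite (commE _ _ _ _ e3 e4 e1 e2).
by rewrite scalerBr scalerA (mulrC l) ksgn_sq scale1r addrA subrK subrr.
Qed.

Lemma comm_even k m (kk : k + k = m) u : ~~ odd `|k| -> comm kk u u = 0.
Proof.
move=> ek; apply: homP => i j e x.
have e1 := erefl (i + k); have e2 : i + k + k = j by lia.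
rewrite (commE _ _ _ _ e1 e2 e1 e2) (@ksgn_odd _ _ 0) ?scale1r ?subrr //.
by rewrite abszM oddM (negbTE ek).
Qed.

Lemma jacobi_zmod (V : zmodType) (P Q S U A W : V) :
  P - Q + (- S + U) = (P - A) + (- W + U) + (A - S + (- Q + W)).
Proof.
rewrite !addrA.
by rewrite [RHS](ACl ((1*7*6*4)*(5*2)*(8*3))%AC) /= !subrr !addr0.
Qed.

Lemma comm_jacobi i j k ij jk ik ijk (eij : i + j = ij) (ejk : j + k = jk)
      (eik : i + k = ik) (ei_jk : i + jk = ijk) (eij_k : ij + k = ijk)
      (ej_ik : j + ik = ijk) a b c :
    comm ei_jk a (comm ejk b c)
    = comm eij_k (comm eij a b) c + ksgn R (i * j) *: comm ej_ik b (comm eik a c).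
Proof.
apply: homP => p q e x; rewrite [RHS]hom_addE hom_scaleE.
have e1 := erefl (p + i); have e2 := erefl (p + j); have e3 := erefl (p + k).
have e4 := erefl (p + i + j); have e5 := erefl (p + j + k).
have e6 := erefl (p + k + i).
have e4' : p + j + i = p + i + j by lia.
have e5' : p + k + j = p + j + k by lia.
have e6' : p + i + k = p + k + i by lia.
have E4 : p + i + j + k = q by lia.
have E5 : p + j + k + i = q by lia.
have E6 : p + k + i + j = q by lia.
have f1 : p + jk = p + j + k by lia.
have f2 : p + ij = p + i + j by lia.
have f3 : p + ik = p + k + i by lia.
have g1 : p + i + jk = q by lia.
have g2 : p + k + ij = q by lia.
have g3 : p + j + ik = q by lia.
rewrite (commE _ _ _ _ f1 E5 e1 g1) (commE _ _ _ _ e3 e5' e2 e5).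
rewrite (commE _ _ _ _ e3 g2 f2 E4) (commE _ _ _ _ f3 E6 e2 g3).
rewrite (commE _ _ _ _ e3 e6 e1 e6') (commE _ _ _ _ e2 e4' e1 e4).
rewrite (commE _ _ _ g1 e6' E6 e4 E4) (commE _ _ _ g2 e5' E5 e6 E6).
rewrite (commE _ _ _ g3 e5 E5 e4' E4).
rewrite !linearB /= !linearZ /= ?scalerBr ?scalerA ?scalerN ?opprK.
rewrite -eij -ejk -eik !mulrDr !mulrDl !ksgnD (mulrC j i).
set s := ksgn R (i * j); set t := ksgn R (i * k); set r := ksgn R (j * k).
rewrite !mulrA !ksgn_sq !mul1r (mulrC (t * r) s) (mulrC r t) mulrA.
set T1 := a _ _ _ (b _ _ _ _); set T2 := a _ _ _ (c _ _ _ _).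
set T3 := b _ _ _ (c _ _ _ _); set T4 := c _ _ _ (b _ _ _ _).
set T5 := b _ _ _ (a _ _ _ _); set T6 := c _ _ _ (a _ _ _ _).
exact: jacobi_zmod.
Qed.
Lemma comm_odd k l m (kk : k + k = l) (kl : k + l = m) u :
  odd `|k| -> comm kl u (comm kk u u) = 0.
Proof.
move=> ok; apply: homP => i j e x.
have e1 := erefl (i + k); have e2 := erefl (i + k + k).
have e3 : i + l = i + k + k by lia.
have e4 : i + k + k + k = j by lia.
have e5 : i + k + l = j by lia.
rewrite (commE _ _ _ _ e3 e4 e1 e5) (commE _ _ _ _ e1 e2 e1 e2).
rewrite (commE _ _ _ _ e2 e4 e2 e4) (@ksgn_odd _ (k * l) 0); last first.
  by rewrite -kk abszM oddM; lia.
rewrite scale1r linearB linearZ /=; exact: subrr.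
Qed.

Definition cx_d_hom : hom C C 1 := Hom (fun i j e => @linearP _ _ _ _ (cx_d C e)).

Lemma comm_dd k l m (kl : 1 + k = l) (lm : 1 + l = m) u :
  comm lm cx_d_hom (comm kl cx_d_hom u) = 0.
Proof.
apply: homP => i j e x.
have e1 := erefl (i + k); have e2 := erefl (i + k + 1).
have e3 : i + l = i + k + 1 by lia.
have e4 : i + k + 1 + 1 = j by lia.
have e5 := erefl (i + 1); have e6 : i + 1 + k = i + k + 1 by lia.
have e7 : i + 1 + l = j by lia.
have e8 := erefl (i + 1 + 1); have e9 : i + 1 + 1 + k = j by lia.
rewrite (commE _ _ _ _ e3 e4 e5 e7) (commE _ _ _ _ e1 e2 e5 e6).
rewrite (commE _ _ _ _ e6 e4 e8 e9) linearB linearZ /= !cx_dd linear0.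
rewrite !scaler0 subr0 sub0r.
rewrite -kl !mul1r ksgnD {2}/ksgn expr1 mulN1r scaleNr subrr.
by [].
Qed.

Fact addC1_deg (k l : int) : k + 1 = l -> 1 + k = l.
Proof. by rewrite addrC. Qed.

(* The differential of Hom^*(C, C) is the bracket with d_C. *)
Definition endo_d k l (e : k + 1 = l) : hom C C k -> hom C C l :=
  comm (addC1_deg e) cx_d_hom.

HB.instance Definition _ k l (e : k + 1 = l) :=
  GRing.isLinear.Build R (hom C C k) (hom C C l) *:%R (endo_d e)
    (comm_linr (addC1_deg e) cx_d_hom).

Fact endo_dd i j k (ij : i + 1 = j) (jk : j + 1 = k) u :
  endo_d jk (endo_d ij u) = 0.
Proof. exact: comm_dd. Qed.

Definition endo_cx : complex := Complex (cx_mod := hom C C) endo_dd.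

Fact comm_leibniz i j k i' j' k' (ij : i + j = k) (kk' : k + 1 = k')
    (ii' : i + 1 = i') (jj' : j + 1 = j') (i'j : i' + j = k')
    (ij' : i + j' = k') u v :
  endo_d kk' (comm ij u v)
  = comm i'j (endo_d ii' u) v + ksgn R i *: comm ij' u (endo_d jj' v).
Proof.
rewrite /endo_d -[in ksgn R i](mul1r i); exact: comm_jacobi.
Qed.

Definition endo_dgla : dgla :=
  @Dgla endo_cx comm comm_linl comm_linr comm_skew comm_even comm_leibniz
    comm_jacobi comm_odd.

End EndoDgla.
Section Truncation.

(* The truncation C^{<0} is C^i for i < 0 and the zero module 'rV_0 for
   i >= 0; tr_inc is the inclusion j and tr_proj the projection pi. *)
Definition trmod (b : bool) (M : lmodType R) : lmodType R :=
  if b then M else 'rV[R]_0.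

Definition trinc (b : bool) (M : lmodType R) : {linear trmod b M -> M} :=
  if b as b return {linear trmod b M -> M} then idfun else \0.

Definition trproj (b : bool) (M : lmodType R) : {linear M -> trmod b M} :=
  if b as b return {linear M -> trmod b M} then idfun else \0.

Lemma trincK (b b' : bool) (M N : lmodType R) (F : M -> N) (y : M) :
  (b' -> b) -> F 0 = 0 ->
  trproj b' N (F (trinc b M (trproj b M y))) = trproj b' N (F y).
Proof. by case: b' => //; case: b => // /(_ isT). Qed.

Variable C : complex.

Definition tr_lt0 (i : int) : lmodType R := trmod (i < 0) (C i).
Definition tr_inc i : {linear tr_lt0 i -> C i} := trinc (i < 0) (C i).
Definition tr_proj i : {linear C i -> tr_lt0 i} := trproj (i < 0) (C i).

Lemma tr_incK i j (F : C i -> C j) (y : C i) : i <= j -> F 0 = 0 ->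
  tr_proj j (F (tr_inc i (tr_proj i y))) = tr_proj j (F y).
Proof.
by move=> ij F0; apply: trincK => // j0; apply: le_lt_trans j0.
Qed.

Definition tr_d i j (e : i + 1 = j) : {linear tr_lt0 i -> tr_lt0 j} :=
  tr_proj j \o (cx_d C e \o tr_inc i).

Fact tr_dd i j k (ij : i + 1 = j) (jk : j + 1 = k) x : tr_d jk (tr_d ij x) = 0.
Proof.
rewrite /tr_d /= tr_incK ?linear0 //; last by lia.
by rewrite cx_dd linear0.
Qed.

Definition trunc_lt0 : complex := Complex tr_dd.

Section TruncHom.
Variables (k : int) (u : hom C C k).

Fact tr_hom_lin i j (e : i + k = j) :
  linear (fun x : trunc_lt0 i => tr_proj j (u i j e (tr_inc i x)) : trunc_lt0 j).
Proof. by move=> a x y; rewrite !linearP. Qed.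

Definition tr_hom : hom trunc_lt0 trunc_lt0 k := Hom tr_hom_lin.
End TruncHom.

Lemma tr_hom_linear k : linear (@tr_hom k).
Proof. by move=> a u v; apply: homP => i j e x; exact: linearP. Qed.

End Truncation.
End Complexes.

Section Exterior.
Variables (R : comPzRingType) (n : nat).

(* E = 'rV[R]_n with basis e_i = delta_mx 0 i. The exterior algebra of E is the
   free module on the e_A = e_{a_1} /\ ... /\ e_{a_k}, A = {a_1 < ... < a_k}, and
   an element is the family of its coordinates. The exterior algebra of the dual
   of E is modelled by the same type, with the dual basis in place of the e_i. *)
Definition extalg := {ffun {set 'I_n} -> R^o}.

Definition ebas (A : {set 'I_n}) : extalg := [ffun B => (B == A)%:R].

(* For i in A, the sign (-1)^(p-1) where i is the p-th element of A. *)
Definition pos_sgn (i : 'I_n) (A : {set 'I_n}) : R :=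
  (-1) ^+ #|[set j in A | (j < i)%N]|.

(* g _| e_A = \sum_p (-1)^(p-1) g(e_{a_p}) e_{A \ a_p} for g in the dual of E,
   extended linearly. Only the values g(e_i) matter; contr1_wedge below gives the
   formula for v_1 /\ ... /\ v_b with arbitrary v_i. *)
Definition contr1 (g : 'rV[R]_n -> R) (w : extalg) : extalg :=
  \sum_(A : {set 'I_n}) w A *:
    \sum_(i in A) (pos_sgn i A * g (delta_mx 0 i)) *: ebas (A :\ i).

Definition dual_e (i : 'I_n) (v : 'rV[R]_n) : R := v 0 i.

(* (e*_{a_1} /\ ... /\ e*_{a_k}) _| w = e*_{a_1} _| (... (e*_{a_k} _| w)), the
   enumeration of A being increasing; extended linearly in psi. The rule
   (g /\ psi) _| w = g _| (psi _| w) for every g in the dual is contr_wedge1. *)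
Definition contr (psi w : extalg) : extalg :=
  \sum_(A : {set 'I_n}) psi A *: foldr (fun i => contr1 (dual_e i)) w (enum A).

Lemma contr1E g w B :
  contr1 g w B = \sum_(i | i \notin B)
     pos_sgn i B * g (delta_mx 0 i) * w (i |: B).
Proof.
rewrite /contr1 sum_ffunE.
under eq_bigr => A _.
  rewrite ffunE sum_ffunE scaler_sumr.
  under eq_bigr => i _ do rewrite !ffunE.
  over.
rewrite (exchange_big_dep xpredT) //= [RHS]big_mkcond /=.
apply: eq_bigr => i _; case: ifPn => [iB|]; last first.
  rewrite negbK => iB; apply: big1 => A iA.
  case: eqP => [E|]; last by rewrite !scaler0.
  by move: iB; rewrite E !inE eqxx.
rewrite (bigD1 (i |: B)) /= ?setU11 // setU1K // eqxx.
rewrite big1 ?addr0 => [|A /andP[iA nA]]; last first.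
  case: eqP => [E|]; last by rewrite !scaler0.
  by move: nA; rewrite E setD1K ?eqxx.
rewrite /GRing.scale /= mulr1 mulrC; congr (_ * _ * _).
rewrite /pos_sgn; congr (_ ^+ #|pred_of_set _|); apply/setP => j.
by rewrite !inE; case: eqP => [->|] //=; rewrite ltnn andbF.
Qed.

Fact contr1_linear g : linear (contr1 g).
Proof.
move=> a u v; apply/ffunP => B.
rewrite !ffunE !contr1E scaler_sumr -big_split /=; apply: eq_bigr => i _.
by rewrite !ffunE mulrDr /GRing.scale /= !mulrA; congr (_ * _ + _); ring.
Qed.

HB.instance Definition _ g :=
  GRing.isLinear.Build R extalg extalg *:%R (contr1 g) (contr1_linear g).

Lemma contr1D g h w : contr1 (fun v => g v + h v) w = contr1 g w + contr1 h w.
Proof.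
apply/ffunP => B; rewrite ffunE !contr1E -big_split /=.
by apply: eq_bigr => i _; rewrite mulrDr mulrDl.
Qed.

Lemma pos_sgnU1 i j (B : {set 'I_n}) : i \notin B ->
  pos_sgn j (i |: B) = (-1) ^+ (i < j)%N * pos_sgn j B.
Proof.
move=> iB; rewrite /pos_sgn -exprD; congr (_ ^+ _).
case: (ltnP i j) => ij /=.
  transitivity #|i |: [set l in B | (l < j)%N]|.
    by apply: eq_card => l; rewrite !inE; case: eqP => [->|//]; rewrite ij.
  by rewrite cardsU1 !inE (negbTE iB).
rewrite add0n; apply: eq_card => l; rewrite !inE.
have [->|_] := eqVneq l i; last by [].
by rewrite ltnNge ij !andbF.
Qed.

Lemma sum_antisym (U : 'I_n -> 'I_n -> R) :
  (forall i, U i i = 0) -> (forall i j, U i j = - U j i) ->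
  \sum_i \sum_j U i j = 0.
Proof.
move=> Uii UN.
have -> : \sum_i \sum_j U i j = \sum_(i < n) \sum_(j < n | (i < j)%N) U i j
                              + \sum_(i < n) \sum_(j < n | (j < i)%N) U i j.
  rewrite -big_split; apply: eq_bigr => i _.
  rewrite (bigID (fun j : 'I_n => (i < j)%N)) /=; congr (_ + _).
  rewrite (bigD1 i) ?ltnn //= Uii add0r; apply: eq_bigl => j.
  by rewrite -leqNgt ltn_neqAle andbC.
rewrite [X in _ + X](exchange_big_dep xpredT) //= -big_split big1 //= => i _.
rewrite -big_split big1 //= => j _; by rewrite (UN i j) addNr.
Qed.

Lemma contr1_sq g w : contr1 g (contr1 g w) = 0.
Proof.
apply/ffunP => B; rewrite contr1E ffunE.
rewrite -[RHS](@sum_antisym (fun i j => if [&& i \notin B, j \notin B & j != i] then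
   (pos_sgn i B * g (delta_mx 0 i)) *
     (pos_sgn j (i |: B) * g (delta_mx 0 j) * w (j |: (i |: B))) else 0)).
- rewrite big_mkcond /=; apply: eq_bigr => i _.
  case: ifP => iB /=; last by rewrite big1.
  rewrite contr1E big_distrr big_mkcond /=; apply: eq_bigr => j _.
  by rewrite !inE negb_or andbC.
- by move=> i; rewrite eqxx !andbF.
move=> i j; rewrite andbCA eq_sym; case: ifP => [/and3P[jB iB ij]|]; last first.
  by rewrite oppr0.
rewrite !pos_sgnU1 // setUCA.
have -> : (-1) ^+ (j < i)%N = - (-1) ^+ (i < j)%N :> R.
  case: (ltngtP i j) => [||/val_inj E]; rewrite ?expr0 ?expr1 ?opprK //.
  by rewrite E eqxx in ij.
by rewrite !(mulrN, mulNr) opprK; ring.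
Qed.

Lemma contr1_anti g h w : contr1 g (contr1 h w) = - contr1 h (contr1 g w).
Proof.
apply/eqP; rewrite -addr_eq0; apply/eqP.
have := contr1_sq (fun v => g v + h v) w.
by rewrite !contr1D !linearD /= !contr1_sq add0r addr0.
Qed.

Definition iota_seq (s : seq 'I_n) (w : extalg) : extalg :=
  foldr (fun i => contr1 (dual_e i)) w s.

Fact iota_seq_linear s : linear (iota_seq s).
Proof.
move=> a u v; elim: s => [//|i s /= ->].
by rewrite linearP.
Qed.

HB.instance Definition _ s :=
  GRing.isLinear.Build R extalg extalg *:%R (iota_seq s) (iota_seq_linear s).

Lemma contr1_iota_seq g s w :
  contr1 g (iota_seq s w) = (-1) ^+ size s *: iota_seq s (contr1 g w).
Proof.
elim: s => [|i s IH] /=; first by rewrite scale1r.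
by rewrite contr1_anti IH linearZ /= exprS mulN1r scaleNr.
Qed.

Lemma iota_seqC s t w :
  iota_seq s (iota_seq t w)
  = (-1) ^+ (size s * size t) *: iota_seq t (iota_seq s w).
Proof.
elim: s => [|i s IH] /=; first by rewrite scale1r.
by rewrite IH linearZ /= contr1_iota_seq scalerA mulSn exprD mulrC.
Qed.

Lemma contrE psi w :
  contr psi w = \sum_(A : {set 'I_n}) psi A *: iota_seq (enum A) w.
Proof. by []. Qed.

Fact contr_linear psi : linear (contr psi).
Proof.
move=> a u v; rewrite !contrE scaler_sumr -big_split /=; apply: eq_bigr => A _.
by rewrite linearP scalerDr !scalerA mulrC.
Qed.

HB.instance Definition _ psi :=
  GRing.isLinear.Build R extalg extalg *:%R (contr psi) (contr_linear psi).

Lemma contr_sum psi (F : {set 'I_n} -> extalg) :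
  contr psi (\sum_A F A) = \sum_A contr psi (F A).
Proof. exact: linear_sum. Qed.

Lemma contr_linearl w : linear (contr^~ w).
Proof.
move=> a u v; rewrite !contrE scaler_sumr -big_split /=; apply: eq_bigr => A _.
by rewrite !ffunE scalerDl scalerA.
Qed.

(* w is homogeneous of degree k *)
Definition ehom (k : int) (w : extalg) : Prop :=
  forall A : {set 'I_n}, #|A|%:Z != k -> w A = 0.

Lemma contr1_ehom g k l w : l + 1 = k -> ehom k w -> ehom l (contr1 g w).
Proof.
move=> e hw B hB; rewrite contr1E big1 // => i iB.
by rewrite hw ?mulr0 // cardsU1 iB; lia.
Qed.

Lemma iota_seq_ehom s k l w :
  l + (size s)%:Z = k -> ehom k w -> ehom l (iota_seq s w).
Proof.
elim: s l => [|i s IH] l /=; first by rewrite addr0 => ->.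
move=> e hw; apply: (@contr1_ehom _ (l + 1)) => //; apply: IH => //; lia.
Qed.

Lemma contr_ehom k l m psi w :
  m + k = l -> ehom k psi -> ehom l w -> ehom m (contr psi w).
Proof.
move=> e hpsi hw B hB; rewrite contrE sum_ffunE big1 // => A _.
rewrite ffunE; have [kA|/hpsi ->] := eqVneq #|A|%:Z k; last by rewrite scale0r.
rewrite (iota_seq_ehom (k := l) (l := m)) ?scaler0 //.
by rewrite -cardE kA.
Qed.

Lemma contr1_contr g k psi w : ehom k psi ->
  contr1 g (contr psi w) = ksgn R k *: contr psi (contr1 g w).
Proof.
move=> hpsi; rewrite !contrE linear_sum scaler_sumr; apply: eq_bigr => A _ /=.
have [kA|/hpsi ->] := eqVneq #|A|%:Z k; last by rewrite !scale0r linear0 scaler0.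
rewrite linearZ /= contr1_iota_seq -cardE -kA /ksgn /=.
by rewrite !scalerA mulrC.
Qed.

Lemma contrC k l psi phi w : ehom k psi -> ehom l phi ->
  contr psi (contr phi w) = ksgn R (k * l) *: contr phi (contr psi w).
Proof.
move=> hpsi hphi; rewrite [contr phi w]contrE [contr psi w]contrE.
rewrite !contr_sum scaler_sumr.
under eq_bigr => A _ do rewrite linearZ /= contrE scaler_sumr.
under [RHS]eq_bigr => A _ do rewrite linearZ /= contrE scaler_sumr scaler_sumr.
rewrite exchange_big /=; apply: eq_bigr => A _; apply: eq_bigr => B _.
have [kA|/hpsi ->] := eqVneq #|A|%:Z k; last by rewrite !(scale0r, scaler0).
have [lB|/hphi ->] := eqVneq #|B|%:Z l; last by rewrite !(scale0r, scaler0).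
rewrite iota_seqC -!cardE -kA -lB -PoszM /ksgn /= !scalerA; congr (_ *: _).
ring.
Qed.

(* The k-th exterior power for every integer k; it is zero for k < 0 or n < k. *)
Definition extpow (k : int) : Type :=
  {ffun {A : {set 'I_n} | #|A|%:Z == k} -> R^o}.
HB.instance Definition _ k := GRing.Lmodule.on (extpow k).

(* inclusion of a component into the exterior algebra, and projection onto it *)
Definition ext_in k (x : extpow k) : extalg :=
  [ffun A => oapp x 0 (insub A)].

Definition ext_part k (w : extalg) : extpow k := [ffun A => w (val A)].

Fact ext_in_linear k : linear (@ext_in k).
Proof.
move=> a x y; apply/ffunP => A; rewrite !ffunE; case: insubP => [u _ _|_] /=.
  by rewrite !ffunE.
by rewrite scaler0 addr0.
Qed.
HB.instance Definition _ k :=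
  GRing.isLinear.Build R (extpow k) extalg *:%R (@ext_in k) (@ext_in_linear k).

Fact ext_part_linear k : linear (ext_part k).
Proof. by move=> a x y; apply/ffunP => A; rewrite !ffunE. Qed.
HB.instance Definition _ k :=
  GRing.isLinear.Build R extalg (extpow k) *:%R (ext_part k) (@ext_part_linear k).

Lemma ext_in_ehom k (x : extpow k) : ehom k (ext_in x).
Proof. by move=> A kA; rewrite ffunE insubN. Qed.

Lemma ext_partK k w : ehom k w -> ext_in (ext_part k w) = w.
Proof.
move=> hw; apply/ffunP => A; rewrite ffunE; case: insubP => [u _ <-|kA] /=.
  by rewrite ffunE.
by rewrite hw.
Qed.

Lemma ext_inK k (x : extpow k) : ext_part k (ext_in x) = x.
Proof. by apply/ffunP => A; rewrite !ffunE valK. Qed.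

Fact ext_dd i j k (_ : i + 1 = j) (_ : j + 1 = k) (x : extpow i) :
  (\0 : {linear extpow j -> extpow k}) ((\0 : {linear extpow i -> extpow j}) x) = 0.
Proof. by []. Qed.

Definition ext_cx : complex R :=
  Complex (cx_mod := extpow) ext_dd.

(* zero differential and zero bracket *)
Definition ext_dgla : dgla R.
Proof.
refine (@Dgla R ext_cx (fun _ _ _ _ _ _ => 0) _ _ _ _ _ _ _).
- by move=> i j k e b a x y; rewrite scaler0 addr0.
- by move=> i j k e b a x y; rewrite scaler0 addr0.
- by move=> *; rewrite scaler0 addr0.
- by [].
- by move=> *; rewrite scaler0 addr0.
- by move=> *; rewrite scaler0 addr0.
- by [].
Defined.

Section Koszul.
Variable f : {scalar 'rV[R]_n}.

Definition kos_d i j (_ : i + 1 = j) (x : extpow (- i)) : extpow (- j) :=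
  ext_part (- j) (contr1 f (ext_in x)).

Fact kos_d_linear i j (e : i + 1 = j) : linear (kos_d e).
Proof. by move=> a x y; rewrite /kos_d !linearP. Qed.
HB.instance Definition _ i j (e : i + 1 = j) :=
  GRing.isLinear.Build R (extpow (- i)) (extpow (- j)) *:%R (kos_d e)
   (kos_d_linear e).

Lemma ext_in_kos_d i j (e : i + 1 = j) x :
  ext_in (kos_d e x) = contr1 f (ext_in x).
Proof.
by apply/ext_partK/contr1_ehom; last apply: ext_in_ehom; lia.
Qed.

Fact kos_dd i j k (ij : i + 1 = j) (jk : j + 1 = k) x :
  kos_d jk (kos_d ij x) = 0.
Proof. by rewrite {1}/kos_d ext_in_kos_d contr1_sq linear0. Qed.

(* K^i is the (-i)-th exterior power of E. *)
Definition koszul : complex R := Complex (cx_mod := fun i => extpow (- i)) kos_dd.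

Section Contraction.
Variables (k : int) (psi : extpow k).

(* i_psi for psi in the k-th exterior power of the dual; it has degree k on K. *)
Definition kos_i i j (_ : i + k = j) (x : koszul i) : koszul j :=
  ext_part (- j) (contr (ext_in psi) (ext_in x)).

Fact kos_i_linear i j (e : i + k = j) : linear (kos_i e).
Proof. by move=> a x y; rewrite /kos_i !linearP. Qed.

Definition contraction : hom koszul koszul k := Hom kos_i_linear.

Lemma ext_in_kos_i i j (e : i + k = j) x :
  ext_in (kos_i e x) = contr (ext_in psi) (ext_in x).
Proof.
by apply/ext_partK/contr_ehom; [|apply: ext_in_ehom|apply: ext_in_ehom]; lia.
Qed.
End Contraction.

(* pi i_psi j *)
Definition i_lt0_fun k (psi : extpow k) : endo_dgla (trunc_lt0 koszul) k :=
  tr_hom (contraction psi).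

Fact i_lt0_linear k : linear (@i_lt0_fun k).
Proof.
move=> a u v; rewrite -tr_hom_linear; congr tr_hom; apply: homP => i j e x.
by rewrite !homE /= /kos_i linearP contr_linearl linearP.
Qed.
HB.instance Definition _ k :=
  GRing.isLinear.Build R (extpow k) (endo_dgla (trunc_lt0 koszul) k) *:%R
    (@i_lt0_fun k) (@i_lt0_linear k).

Lemma ext_in_inj k : injective (@ext_in k).
Proof. exact: can_inj (@ext_inK k). Qed.

Lemma extpow_lt0 k (psi : extpow k) : k < 0 -> psi = 0.
Proof.
move=> k0; apply/ffunP => -[A kA]; exfalso; move: k0.
by rewrite -(eqP kA).
Qed.

Lemma contraction_tr k (psi : extpow k) i j (e : i + k = j) (y : koszul i) :
  tr_proj koszul j (contraction psi i j e (tr_inc koszul i (tr_proj koszul i y)))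
  = tr_proj koszul j (contraction psi i j e y).
Proof.
have [k0|k0] := ltP k 0; last first.
  by apply: tr_incK; [lia | rewrite linear0].
have Z z : contraction psi i j e z = 0.
  apply: ext_in_inj; rewrite ext_in_kos_i (extpow_lt0 psi k0) !linear0.
  by rewrite /contr big1 // => A _; rewrite ffunE scale0r.
by rewrite !Z.
Qed.

Fact i_lt0_d i j (e : i + 1 = j) (a : ext_dgla i) :
  i_lt0_fun (cx_d ext_dgla e a)
  = cx_d (endo_dgla (trunc_lt0 koszul)) e (i_lt0_fun a).
Proof.
rewrite [LHS](_ : _ = 0); last exact: (linear0 (@i_lt0_fun j)).
apply: homP => p q e' x; rewrite [LHS]hom_zeroE.
have e1 := erefl (p + i); have e2 : p + i + 1 = q by lia.
have e3 := erefl (p + 1); have e4 : p + 1 + i = q by lia.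
rewrite [RHS](commE (addC1_deg e) (cx_d_hom _) (i_lt0_fun a) e' e1 e2 e3 e4) /=.
rewrite contraction_tr tr_incK ?linear0 //; last by lia.
rewrite -linearZ -linearB /= -[LHS](linear0 (tr_proj koszul q)).
congr (tr_proj _ _ _); apply: ext_in_inj.
rewrite linear0 linearB /= linearZ /= ext_in_kos_d !ext_in_kos_i ext_in_kos_d.
by rewrite (contr1_contr _ _ (@ext_in_ehom _ a)) mul1r subrr.
Qed.

Fact i_lt0_brk i j k (e : i + j = k) (a : ext_dgla i) (b : ext_dgla j) :
  i_lt0_fun (brk e a b)
  = brk (d := endo_dgla (trunc_lt0 koszul)) e (i_lt0_fun a) (i_lt0_fun b).
Proof.
rewrite [LHS](_ : _ = 0); last exact: (linear0 (@i_lt0_fun k)).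
apply: homP => p q e' x; rewrite [LHS]hom_zeroE.
have e1 := erefl (p + j); have e2 : p + j + i = q by lia.
have e3 := erefl (p + i); have e4 : p + i + j = q by lia.
rewrite [RHS](commE e (i_lt0_fun a) (i_lt0_fun b) e' e1 e2 e3 e4) /= !contraction_tr.
rewrite -linearZ -linearB /= -[LHS](linear0 (tr_proj koszul q)).
congr (tr_proj _ _ _); apply: ext_in_inj.
rewrite linear0 linearB /= linearZ /= !ext_in_kos_i.
by rewrite (contrC _ (@ext_in_ehom _ a) (@ext_in_ehom _ b)) subrr.
Qed.

Definition i_lt0 : dgla_mor ext_dgla (endo_dgla (trunc_lt0 koszul)) :=
  @DglaMor R ext_dgla (endo_dgla (trunc_lt0 koszul))
    (fun k => @i_lt0_fun k) i_lt0_d i_lt0_brk.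

End Koszul.

(* v /\ w for v in E. The lemmas from here on serve only to identify the above
   coordinate model: v /\ v /\ w = 0, ebas A is the product of the e_i, i in A, in
   increasing order, and contr1, contr satisfy the defining recursion of the
   internal product. *)
Definition wedge1 (v : 'rV[R]_n) (w : extalg) : extalg :=
  \sum_(A : {set 'I_n}) w A *:
    \sum_(i | i \notin A) (pos_sgn i A * v 0 i) *: ebas (i |: A).

Lemma pos_sgnD1 i (B : {set 'I_n}) : pos_sgn i (B :\ i) = pos_sgn i B.
Proof.
rewrite /pos_sgn; congr (_ ^+ _); apply: eq_card => j; rewrite !inE.
by have [->|_] := eqVneq j i; rewrite ?ltnn ?andbF.
Qed.

Lemma pos_sgn_sq i (B : {set 'I_n}) : pos_sgn i B * pos_sgn i B = 1.
Proof. by rewrite -expr2 sqrr_sign. Qed.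

Lemma wedge1E v w B :
  wedge1 v w B = \sum_(i in B) pos_sgn i B * v 0 i * w (B :\ i).
Proof.
rewrite /wedge1 sum_ffunE.
under eq_bigr => A _.
  rewrite ffunE sum_ffunE scaler_sumr.
  under eq_bigr => i _ do rewrite !ffunE.
  over.
rewrite (exchange_big_dep xpredT) //= [RHS]big_mkcond /=.
apply: eq_bigr => i _; case: ifPn => iB; last first.
  apply: big1 => A iA; case: eqP => [E|]; last by rewrite !scaler0.
  by move: iB; rewrite E !inE eqxx.
rewrite (bigD1 (B :\ i)) /= ?setD11 // setD1K // eqxx.
rewrite big1 ?addr0 => [|A /andP[iA nA]]; last first.
  case: eqP => [E|]; last by rewrite !scaler0.
  by move: nA; rewrite E setU1K ?eqxx.
by rewrite /GRing.scale /= mulr1 mulrC pos_sgnD1.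
Qed.

Fact wedge1_linear v : linear (wedge1 v).
Proof.
move=> a u w; apply/ffunP => B.
rewrite !ffunE !wedge1E scaler_sumr -big_split /=; apply: eq_bigr => i _.
by rewrite !ffunE mulrDr /GRing.scale /= !mulrA; congr (_ * _ + _); ring.
Qed.
HB.instance Definition _ v :=
  GRing.isLinear.Build R extalg extalg *:%R (wedge1 v) (wedge1_linear v).

Lemma contr1_eE i w B :
  contr1 (dual_e i) w B = if i \in B then 0 else pos_sgn i B * w (i |: B).
Proof.
rewrite contr1E big_mkcond (bigD1 i) //= /dual_e mxE !eqxx mulr1 big1 => [|j ji].
  by rewrite addr0; case: (i \in B).
by case: ifP => // _; rewrite mxE eq_sym (negbTE ji) mulr0 mul0r.
Qed.

Lemma wedge1_eE i w B :
  wedge1 (delta_mx 0 i) w B = if i \in B then pos_sgn i B * w (B :\ i) else 0.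
Proof.
rewrite wedge1E big_mkcond (bigD1 i) //= mxE !eqxx mulr1 big1 => [|j ji].
  by rewrite addr0; case: (i \in B).
by case: ifP => // _; rewrite mxE (negbTE ji) mulr0 mul0r.
Qed.

Lemma contr1_sum g w :
  contr1 g w = \sum_i g (delta_mx 0 i) *: contr1 (dual_e i) w.
Proof.
apply/ffunP => B; rewrite contr1E sum_ffunE big_mkcond /=.
apply: eq_bigr => i _; rewrite ffunE contr1_eE; case: (i \in B) => /=.
  by rewrite scaler0.
by rewrite [RHS]mulrA [_ * pos_sgn _ _]mulrC.
Qed.

Lemma wedge1_sum v w : wedge1 v w = \sum_i v 0 i *: wedge1 (delta_mx 0 i) w.
Proof.
apply/ffunP => B; rewrite wedge1E sum_ffunE big_mkcond /=.
apply: eq_bigr => i _; rewrite ffunE wedge1_eE; case: ifP => _ /=.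
  by rewrite [RHS]mulrA [_ * pos_sgn _ _]mulrC.
by rewrite scaler0.
Qed.

Lemma contr1_wedge1_e i j w :
  contr1 (dual_e i) (wedge1 (delta_mx 0 j) w)
  = (i == j)%:R *: w - wedge1 (delta_mx 0 j) (contr1 (dual_e i) w).
Proof.
apply/eqP; rewrite eq_sym subr_eq; apply/eqP/ffunP => B.
rewrite !ffunE contr1_eE !wedge1_eE contr1_eE !inE.
have [<-|ij] := eqVneq i j; rewrite /= ?scale1r ?scale0r.
  case: ifP => iB; first by rewrite add0r pos_sgnD1 mulrA pos_sgn_sq mul1r setD1K.
  by rewrite addr0 setU1K ?iB // -(pos_sgnD1 i (i |: B)) setU1K ?iB // mulrA pos_sgn_sq mul1r.
case iB: (i \in B) => /=; first by case: ifP; rewrite ?mulr0 addr0.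
case: ifP => jB; last by rewrite mulr0 addr0.
have -> : (i |: B) :\ j = i |: (B :\ j).
  by apply/setP => l; rewrite !inE; have [->|] := eqVneq l j; rewrite // eq_sym (negbTE ij).
rewrite -[in pos_sgn i B](setD1K jB) !pos_sgnU1 ?iB ?setD11 //.
have -> : (-1) ^+ (j < i)%N = - (-1) ^+ (i < j)%N :> R.
  case: (ltngtP i j) => [||/val_inj E]; rewrite ?expr0 ?expr1 ?opprK //.
  by rewrite E eqxx in ij.
have := sqrr_sign R (i < j)%N; rewrite expr2; move: (_ ^+ (i < j)%N) => e ee.
rewrite -[X in _ = _ + X]mul1r -ee; ring.
Qed.

Lemma contr1_wedge1 (g : {scalar 'rV[R]_n}) v w :
  contr1 g (wedge1 v w) = g v *: w - wedge1 v (contr1 g w).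
Proof.
have -> : g v = \sum_i g (delta_mx 0 i) * v 0 i.
  rewrite {1}(row_sum_delta v) linear_sum; apply: eq_bigr => i _.
  by rewrite linearZ mulrC.
rewrite [LHS]contr1_sum scaler_suml.
have -> : wedge1 v (contr1 g w)
  = \sum_i g (delta_mx 0 i) *: wedge1 v (contr1 (dual_e i) w).
  rewrite contr1_sum linear_sum; apply: eq_bigr => i _; exact: linearZ.
rewrite -sumrB; apply: eq_bigr => i _.
rewrite -scalerA -scalerBr; congr (_ *: _).
rewrite [in LHS]wedge1_sum [X in _ = _ - X]wedge1_sum linear_sum /=.
under eq_bigr => j _ do rewrite linearZ /= contr1_wedge1_e scalerBr.
rewrite sumrB; congr (_ - _); rewrite (bigD1 i) //= eqxx scale1r big1 ?addr0 //.
by move=> j ji; rewrite eq_sym (negbTE ji) scale0r scaler0.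
Qed.

Lemma contr1_1 g : contr1 g (ebas set0) = 0.
Proof.
apply/ffunP => B; rewrite contr1E ffunE big1 // => i _.
rewrite ffunE; case: eqP => [E|]; last by rewrite mulr0.
by have := setU11 i B; rewrite E inE.
Qed.

Lemma contr1_wedge (g : {scalar 'rV[R]_n}) (vs : seq 'rV[R]_n) :
  contr1 g (foldr wedge1 (ebas set0) vs)
  = \sum_(i < size vs) ((-1) ^+ i * g vs`_i) *:
      foldr wedge1 (ebas set0) (take i vs ++ drop i.+1 vs).
Proof.
elim: vs => [|v vs IH]; first by rewrite big_ord0 contr1_1.
rewrite [LHS]contr1_wedge1 IH big_ord_recl /= mul1r drop0; congr (_ + _).
rewrite [wedge1 _ _]linear_sum -sumrN; apply: eq_bigr => i _.
by rewrite linearZ /= /bump add1n exprS !mulN1r mulNr scaleNr.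
Qed.

Lemma wedge1_e_ebas i A : wedge1 (delta_mx 0 i) (ebas A)
  = if i \in A then 0 else pos_sgn i A *: ebas (i |: A).
Proof.
apply/ffunP => B; rewrite wedge1_eE !ffunE.
have [iA|iA] := boolP (i \in A).
  rewrite ffunE; case: ifP => // iB; case: eqP => [E|]; last by rewrite mulr0.
  by rewrite -E !inE eqxx in iA.
rewrite !ffunE; case: (eqVneq B (i |: A)) => [->|BA].
  by rewrite setU11 setU1K // eqxx -(pos_sgnD1 i (i |: A)) setU1K.
rewrite scaler0; case: ifP => // iB.
by case: eqP => [E|]; [rewrite -E setD1K ?eqxx in BA | rewrite mulr0].
Qed.

Lemma sorted_enum (A : {set 'I_n}) : sorted (relpre val ltn) (enum A).
Proof.
rewrite /enum_mem; apply: sorted_filter => [x y z|]; first exact: ltn_trans.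
by rewrite -sorted_map -enumT val_enum_ord; apply: iota_ltn_sorted.
Qed.

Lemma ebas_wedge (A : {set 'I_n}) :
  ebas A = foldr wedge1 (ebas set0) [seq delta_mx 0 i | i <- enum A].
Proof.
have := sorted_enum A; rewrite -{2}[A](set_enum A).
elim: (enum A) => [_|i s IH] /=; first by congr ebas; apply/setP => j; rewrite !inE.
rewrite (path_sortedE (leT := relpre val ltn)) => [/andP[/allP is_ /IH <-]|]; last first.
  by move=> x y z; exact: ltn_trans.
rewrite wedge1_e_ebas inE; case: ifP => [/is_ /=|_]; first by rewrite ltnn.
rewrite (_ : pos_sgn _ _ = 1) ?scale1r.
  by congr ebas; apply/setP => j; rewrite !inE.
rewrite /pos_sgn (_ : [set j in _ | _] = set0) ?cards0 //.
apply/setP => j; rewrite !inE; apply/negP => /andP[/is_ /= ij ji].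
by have := ltn_trans ij ji; rewrite ltnn.
Qed.

Lemma iota_seq_setU1 i (B : {set 'I_n}) w : i \notin B ->
  iota_seq (enum (i |: B)) w
  = pos_sgn i B *: contr1 (dual_e i) (iota_seq (enum B) w).
Proof.
move=> iB; have := sorted_enum setT.
have := mem_enum setT i; rewrite inE.
have En (A : {set 'I_n}) : enum A = filter (mem A) (enum [set: 'I_n]).
  by rewrite /enum_mem -filter_predI; apply: eq_filter => j; rewrite /= !inE andbT.
have -> : pos_sgn i B
    = (-1) ^+ count (fun j : 'I_n => (j \in B) && (j < i)%N) (enum [set: 'I_n]).
  rewrite /pos_sgn cardE En size_filter; congr (_ ^+ _).
  by apply: eq_count => j; rewrite /= inE.
rewrite (En (i |: B)) (En B); case/splitPr => s t.
rewrite sorted_pairwise => [|x y z]; last exact: ltn_trans.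
rewrite pairwise_cat /= allrel_consr -!andbA => /and5P[/allP si _ _ /allP it _].
have F (r : seq 'I_n) : i \notin r ->
    filter (mem (i |: B)) r = filter (mem B) r.
  move=> ir; apply: eq_in_filter => j jr; rewrite /= !inE.
  by case: eqP => // ji; rewrite -ji jr in ir.
have C r r' : iota_seq (r ++ r') w = iota_seq r (iota_seq r' w).
  exact: foldr_cat.
rewrite !filter_cat count_cat /= setU11 (negbTE iB) !F; first last.
- by apply/negP => /si /=; rewrite ltnn.
- by apply/negP => /it /=; rewrite ltnn.
rewrite !C /= [X in _ = _ *: X]contr1_iota_seq scalerA size_filter.
have -> : count (fun j : 'I_n => (j \in B) && (j < i)%N) s = count (mem B) s.
  by apply: eq_in_count => j /si /= ->; rewrite andbT.
have -> : count (fun j : 'I_n => (j \in B) && (j < i)%N) t = 0%N.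
  apply/eqP; rewrite -leqn0 leqNgt -has_count; apply/hasPn => j /it /= ij.
  by rewrite negb_and -leqNgt (ltnW ij) orbT.
by rewrite !addn0 -expr2 sqrr_sign scale1r.
Qed.

Lemma contr_ebas A w : contr (ebas A) w = iota_seq (enum A) w.
Proof.
rewrite contrE (bigD1 A) //= ffunE eqxx scale1r big1 ?addr0 // => B BA.
by rewrite ffunE (negbTE BA) scale0r.
Qed.

Lemma contr_wedge1 v psi w :
  contr (wedge1 v psi) w = contr1 (fun u => \sum_i v 0 i * u 0 i) (contr psi w).
Proof.
have Cl I (r : seq I) (F : I -> extalg) :
    contr (\sum_(x <- r) F x) w = \sum_(x <- r) contr (F x) w.
  elim: r => [|x r IH]; last first.
    by have := contr_linearl w 1 (F x) (\sum_(y <- r) F y); rewrite !big_cons IH !scale1r.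
  by rewrite !big_nil contrE big1 // => A _; rewrite ffunE scale0r.
have Cz c u : contr (c *: u) w = c *: contr u w.
  rewrite -[c *: u]addr0 contr_linearl.
  by rewrite [contr 0 w]contrE [X in _ + X]big1 ?addr0 // => A _; rewrite ffunE scale0r.
rewrite wedge1_sum Cl contr1_sum; apply: eq_bigr => i _.
rewrite Cz (bigD1 i) //= mxE !eqxx mulr1 big1 ?addr0 => [|j ji]; last first.
  by rewrite mxE (negbTE ji) mulr0.
congr (_ *: _).
have {1}-> : psi = \sum_A psi A *: ebas A.
  apply/ffunP => B; rewrite sum_ffunE (bigD1 B) //= !ffunE eqxx big1 ?addr0.
    by rewrite /GRing.scale /= mulr1.
  by move=> A AB; rewrite !ffunE eq_sym (negbTE AB) scaler0.
rewrite linear_sum Cl contrE linear_sum; apply: eq_bigr => A _ /=.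
rewrite !linearZ /= Cz wedge1_e_ebas; congr (_ *: _); case: ifPn => iA; last first.
  by rewrite Cz contr_ebas iota_seq_setU1 // scalerA pos_sgn_sq scale1r.
rewrite -[in RHS](setD1K iA) iota_seq_setU1 ?setD11 // linearZ /= contr1_sq.
by rewrite scaler0 contrE big1 // => B _; rewrite ffunE scale0r.
Qed.

Lemma wedge1_sq v w : wedge1 v (wedge1 v w) = 0.
Proof.
apply/ffunP => B; rewrite wedge1E ffunE.
rewrite -[RHS](@sum_antisym (fun i j => if [&& i \in B, j \in B & j != i] then
   (pos_sgn i B * v 0 i) *
     (pos_sgn j (B :\ i) * v 0 j * w (B :\ i :\ j)) else 0)).
- rewrite big_mkcond /=; apply: eq_bigr => i _.
  case: ifP => iB /=; last by rewrite big1.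
  rewrite wedge1E big_distrr big_mkcond /=; apply: eq_bigr => j _.
  by rewrite !inE andbC.
- by move=> i; rewrite eqxx !andbF.
move=> i j; rewrite andbCA eq_sym; case: ifP => [/and3P[jB iB ij]|]; last first.
  by rewrite oppr0.
have -> : B :\ i :\ j = B :\ j :\ i by rewrite !setDDl setUC.
have S k l : l \in B -> pos_sgn k B = (-1) ^+ (l < k)%N * pos_sgn k (B :\ l).
  by move=> lB; rewrite -{1}(setD1K lB) pos_sgnU1 ?setD11.
rewrite (S i j) // (S j i) //.
have -> : (-1) ^+ (j < i)%N = - (-1) ^+ (i < j)%N :> R.
  case: (ltngtP i j) => [||/val_inj E]; rewrite ?expr0 ?expr1 ?opprK //.
  by rewrite E eqxx in ij.
move: (_ ^+ (i < j)%N) => e; ring.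
Qed.

End Exterior.

(* Main.v *)
(** Let T = K^{<0} and let u be a cocycle of degree k in Hom^*(T, T). Composing
    its component K^{-k-1} -> K^{-1} with the differential K^{-1} -> R gives a
    form a in the (k+1)-st exterior power of the dual of E with f /\ a = 0. The
    Koszul complex is self-dual, so its exactness makes a = f /\ b, except in top
    degree, where a = f /\ b because a takes its values in the ideal
    (f_1, ..., f_n). Up to sign, b is the component of a contraction i_psi with
    values in K^0 = R, hence u - i_psi maps T^{-k-1} to cycles of K^{-1}, that is,
    to boundaries. As T is bounded, degreewise free and exact below degree -1,
    such a cocycle is null-homotopic. *)

From HB Require Import structures.
Require Import Defs.
From mathcomp Require Import all_boot all_order all_algebra.
From mathcomp Require Import boolp zify ring.

Set Implicit Arguments.
Unset Strict Implicit.
Unset Printing Implicit Defensive.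

Import Order.TTheory GRing.Theory Num.Theory.
Local Open Scope ring_scope.

(** * Projective modules and null-homotopies *)

(** Lifting is along any [g] whose image contains that of [u], so that it applies directly to a
    differential and a map with values in boundaries. *)
Definition projective (R : comPzRingType) (M : lmodType R) : Prop :=
  forall (N P : lmodType R) (g : {linear N -> P}) (u : {linear M -> P}),
  (forall x, exists y, g y = u x) ->
  exists h : {linear M -> N}, forall x, g (h x) = u x.

Lemma coboundaryP (R : comPzRingType) (C : complex R) i j (e : i + 1 = j)
    (x : C j) : coboundary x -> exists y : C i, cx_d C e y = x.
Proof.
case=> i' [e' [y ->]]; have E : i' = i by lia.
by subst i'; exists y; rewrite (eq_irrelevance e e').
Qed.

Lemma coboundary0 (R : comPzRingType) (C : complex R) j :
  coboundary (0 : C j).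
Proof. by exists (j - 1), (subrK _ _), 0; rewrite linear0. Qed.

Lemma coboundaryB (R : comPzRingType) (C : complex R) j (x y : C j) :
  coboundary x -> coboundary y -> coboundary (x - y).
Proof.
case=> i [e [a ->]] /(coboundaryP e)[b <-].
by exists i, e, (a - b); rewrite linearB.
Qed.

Lemma endo_dE (R : comPzRingType) (C : complex R) k l (e : k + 1 = l)
    (u : endo_cx C k) i j p q (ij : i + l = j) (ip : i + k = p) (pj : p + 1 = j)
    (iq : i + 1 = q) (qj : q + k = j) x :
  (cx_d (endo_cx C) e u : endo_cx C l) i j ij x
  = cx_d C pj (u i p ip x) - ksgn R k *: u q j qj (cx_d C iq x).
Proof.
by rewrite [LHS](commE (addC1_deg e) (cx_d_hom C) u ij ip pj iq qj) mul1r.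
Qed.

Lemma endo_cocycleE (R : comPzRingType) (C : complex R) k (u : endo_cx C k)
    i j p q (ip : i + k = p) (pj : p + 1 = j) (iq : i + 1 = q) (qj : q + k = j)
    x :
  cocycle u -> cx_d C pj (u i p ip x) = ksgn R k *: u q j qj (cx_d C iq x).
Proof.
move=> cu; have e : i + (k + 1) = j by lia.
apply/eqP; rewrite -subr_eq0 -(endo_dE (erefl (k + 1)) u e); apply/eqP.
by rewrite [cx_d _ _ u]cu.
Qed.

(* One step of the descending construction of a null-homotopy: h lives only on
   the components of u with target in degree p. *)
Lemma homotopy_step (R : comPzRingType) (C : complex R) (k l p : int) (e : l + 1 = k)
    (u : endo_cx C k) :
  (forall i, projective (C i)) ->
  (forall i j (ij : i + k = j) x, p < j -> u i j ij x = 0) ->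
  (forall i (ip : i + k = p) x, coboundary (u i p ip x)) ->
  exists h : endo_cx C l, forall i j (ij : i + k = j) x, p <= j ->
    (u - cx_d (endo_cx C) e h : endo_cx C k) i j ij x = 0.
Proof.
move=> prC u0 up.
have H i j (ij : i + l = j) : exists g : {linear C i -> C j},
    (forall (jp : j + 1 = p) (ip : i + k = p) x, cx_d C jp (g x) = u i p ip x)
    /\ (j + 1 <> p -> forall x, g x = 0).
  have [jp|jp] := eqVneq (j + 1) p; last first.
    by exists \0; split=> // jp'; rewrite jp' eqxx in jp.
  have ip : i + k = p by lia.
  have [|g gu] := prC i _ _ (cx_d C jp) (u i p ip).
    by move=> x; apply/coboundaryP/up.
  exists g; split=> // jp' ip' x.
  by rewrite (eq_irrelevance jp' jp) (eq_irrelevance ip' ip).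
pose h : Defs.hom C C l := @Defs.Hom _ _ _ _ (fun i j ij => projT1 (cid (H i j ij)))
  (fun i j ij => @linearP _ _ _ _ (projT1 (cid (H i j ij)))).
have hu i j (ij : i + l = j) (jp : j + 1 = p) (ip : i + k = p) x :
    cx_d C jp (h i j ij x) = u i p ip x.
  by rewrite /h /=; case: cid => g [] gu _ /=; exact: gu.
have h0 i j (ij : i + l = j) x : j + 1 <> p -> h i j ij x = 0.
  by rewrite /h /=; case: cid => g [] _ gu jp /=; exact: gu.
exists h => i j ij x pj.
have e1 := erefl (i + l); have e2 : i + l + 1 = j by lia.
have e3 := erefl (i + 1); have e4 : i + 1 + l = j by lia.
rewrite hom_addE hom_oppE (endo_dE e h ij e1 e2 e3 e4).
(* The term [h d] has target degree [j >= p], while [h] is nonzero only into degree [p - 1]. *)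
rewrite [h _ _ e4 _]h0 ?scaler0 ?subr0; last by lia.
move: pj; rewrite le_eqVlt => /predU1P[E|pj].
  by subst p; rewrite (hu _ _ _ _ ij) subrr.
by rewrite u0 // h0 ?linear0 ?addr0 //; lia.
Qed.

(** Induction on [c], which bounds the number of degrees up to [p] where [C] lives: [homotopy_step]
    clears the components into degree [p] by subtracting a coboundary, and the induction resumes at
    [p - 1]. *)
Lemma endo_coboundary (R : comPzRingType) (C : complex R) (k p : int) (c : nat)
    (u : endo_cx C k) :
  (forall i, projective (C i)) ->
  (forall j (x : C j), j <= p - c%:Z -> x = 0) ->
  (forall j (x : C j), j < p -> cocycle x -> coboundary x) ->
  cocycle u ->
  (forall i j (ij : i + k = j) x, p < j -> u i j ij x = 0) ->
  (forall i (ip : i + k = p) x, coboundary (u i p ip x)) ->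
  coboundary u.
Proof.
move=> prC; elim: c p u => [|c IH] p u C0 exC cu u0 up.
  suff -> : u = 0 by exact: coboundary0.
  apply: homP => i j e x; have [pj|jp] := ltP p j; first exact: u0.
  by apply: C0; rewrite subr0.
have e : (k - 1) + 1 = k by lia.
have [h uh] := homotopy_step e prC u0 up.
have -> : u = (u - cx_d _ e h) - - cx_d _ e h by rewrite opprK subrK.
have cv : cocycle (u - cx_d _ e h).
  by rewrite /cocycle linearB [cx_d _ _ u]cu (@cx_dd _ (endo_cx C)) subr0.
apply: coboundaryB; last by exists (k - 1), e, (- h); rewrite linearN.
apply: (IH (p - 1) _) => //.
- by move=> j x jp; apply: C0; lia.
- by move=> j x jp; apply: exC; lia.
- by move=> i j ij x jp; apply: uh; lia.
(* The corrected cocycle commutes with the differential up to sign and already vanishes into degree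
   [p], so its values in degree [p - 1] are cycles. *)
move=> i ip x; apply: exC; first by lia.
have jq : i + 1 + k = p - 1 + 1 by lia.
by rewrite /cocycle (endo_cocycleE _ _ (erefl _) jq) // uh ?scaler0 //; lia.
Qed.

(** * Projectivity of the terms and properties of the truncation *)

Lemma ext_projective (R : comPzRingType) n k : projective (extpow R n k).
Proof.
move=> N P g u gu.
pose b A : extpow R n k := [ffun B => (B == A)%:R].
pose y A := projT1 (cid (gu (b A))).
have yE A : g (y A) = u (b A) by rewrite /y; case: cid.
pose h (x : extpow R n k) := \sum_A (x A : R) *: y A.
have hl : linear h.
  move=> a x z; rewrite /h scaler_sumr -big_split /=; apply: eq_bigr => A _.
  by rewrite !ffunE scalerDl scalerA.
pose hL := GRing.isLinear.Build R _ _ _ h hl.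
exists (HB.pack_for {linear extpow R n k -> N} h hL) => x /=.
have sbE A B : (x A *: b A) B = x A * (B == A)%:R :> R by rewrite ffunE ffunE.
have {2}-> : x = \sum_A (x A : R) *: b A.
  apply/ffunP => B; rewrite sum_ffunE (eq_bigr _ (fun A _ => sbE A B)).
  rewrite (bigD1 B) //= eqxx mulr1 big1 ?addr0 // => A AB.
  by rewrite eq_sym (negbTE AB) mulr0.
rewrite !linear_sum; apply: eq_bigr => A _.
by rewrite !linearZ /= yE.
Qed.

Lemma tr_projective (R : comPzRingType) (C : complex R) i :
  projective (C i) -> projective (tr_lt0 C i).
Proof.
rewrite /tr_lt0; case: (i < 0) => //= _ N P g u _.
by exists \0 => x; rewrite [x]thinmx0 !linear0.
Qed.

Lemma tr_ge0 (R : comPzRingType) (C : complex R) i (x : tr_lt0 C i) :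
  0 <= i -> x = 0.
Proof.
by rewrite leNgt; move: x; rewrite /tr_lt0; case: (i < 0) => // x _; exact: thinmx0.
Qed.

Lemma tr_projK (R : comPzRingType) (C : complex R) i (x : tr_lt0 C i) :
  tr_proj C i (tr_inc C i x) = x.
Proof.
move: x; rewrite /tr_proj /tr_inc /tr_lt0; case: (i < 0) => //= x.
by rewrite [x]thinmx0.
Qed.

Lemma tr_incK_lt0 (R : comPzRingType) (C : complex R) i (x : C i) :
  i < 0 -> tr_inc C i (tr_proj C i x) = x.
Proof. by rewrite /tr_proj /tr_inc /tr_lt0; case: (i < 0). Qed.

Lemma tr_inc_d (R : comPzRingType) (C : complex R) i j (e : i + 1 = j)
    (x : trunc_lt0 C i) : j < 0 ->
  tr_inc C j (cx_d (trunc_lt0 C) e x) = cx_d C e (tr_inc C i x).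
Proof. by move=> j0; rewrite /= tr_incK_lt0. Qed.

(** A preimage under the differential of [C] sits in degree [j - 1 < 0], which the truncation
    keeps. *)
Lemma tr_coboundary (R : comPzRingType) (C : complex R) j
    (x : trunc_lt0 C j) :
  j < 0 -> coboundary (tr_inc C j x) -> coboundary x.
Proof.
move=> j0 [i [e [y xy]]]; exists i, e, (tr_proj C i y).
rewrite -[LHS]tr_projK xy /= tr_incK_lt0 //; lia.
Qed.

(** * Duality: the pairing and the star operator *)

(* The pairing of the exterior powers of E and of its dual for which the e_A and
   the e*_A are dual bases. *)
Definition pairing (R : comPzRingType) n (b w : extalg R n) : R :=
  \sum_A (b A : R) * w A.

Lemma pairing_ebas (R : comPzRingType) n (b : extalg R n) B :
  pairing b (ebas R B) = b B.
Proof.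
rewrite /pairing (bigD1 B) //= ffunE eqxx mulr1 big1 ?addr0 // => A AB.
by rewrite ffunE (negbTE AB) mulr0.
Qed.

Lemma pairing_linear (R : comPzRingType) n (b : extalg R n) :
  linear (pairing b : extalg R n -> R^o).
Proof.
move=> a v w; rewrite /pairing scaler_sumr -big_split /=.
by apply: eq_bigr => A _; rewrite !ffunE mulrDr /GRing.scale /= mulrCA.
Qed.

Lemma extalg_sum (R : comPzRingType) n (w : extalg R n) :
  w = \sum_A (w A : R) *: ebas R A.
Proof.
apply/ffunP => B; rewrite sum_ffunE (bigD1 B) //= !ffunE eqxx big1 ?addr0.
  by rewrite /GRing.scale /= mulr1.
by move=> A AB; rewrite !ffunE eq_sym (negbTE AB) scaler0.
Qed.

Lemma pairingC (R : comPzRingType) n (b w : extalg R n) :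
  pairing b w = pairing w b.
Proof. by apply: eq_bigr => A _; rewrite mulrC. Qed.

(** The row of the values f(e_i) is [f] in the dual basis, so [wedge1] is here the product with [f]
    in the exterior algebra of the dual. *)
Lemma pairing_wedge1 (R : comPzRingType) n (f : 'rV[R]_n -> R)
    (b w : extalg R n) :
  pairing (wedge1 (\row_i f (delta_mx 0 i)) b) w = pairing b (contr1 f w).
Proof.
pose P := HB.pack_for {linear extalg R n -> R^o} (pairing w)
  (GRing.isLinear.Build R _ _ _ (pairing w : extalg R n -> R^o)
    (pairing_linear w)).
rewrite pairingC -[LHS]/(P _) linear_sum; apply: eq_bigr => A _.
rewrite linearZ contr1E linear_sum; congr (_ * _); apply: eq_bigr => i _.
by rewrite linearZ /= pairing_ebas mxE.
Qed.

(** The indices below [i] split between [B] and its complement. *)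
Lemma pos_sgn_compl (R : comPzRingType) n (i : 'I_n) (B : {set 'I_n}) :
  pos_sgn R i B * pos_sgn R i (~: B) = (-1) ^+ i.
Proof.
rewrite /pos_sgn -exprD; congr (_ ^+ _).
transitivity #|[set j : 'I_n | (j < i)%N]|; last first.
  rewrite -sum1dep_card (big_ord_narrow (ltnW (ltn_ord i))) /=.
  by rewrite sum1_card card_ord.
rewrite -[RHS](cardsID B); congr (_ + _)%N; apply: eq_card => j; rewrite !inE //.
by rewrite andbC.
Qed.

(* The sign is chosen so that star intertwines f /\ _ and contraction with f
   without further signs (contr1_star). *)
Definition star (R : comPzRingType) n (w : extalg R n) : extalg R n :=
  [ffun B : {set 'I_n} => (\prod_(i in B) (-1) ^+ i : R) * w (~: B)].

Lemma star_star (R : comPzRingType) n (w : extalg R n) :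
  star (star w) = (\prod_(i < n) (-1) ^+ i : R) *: w.
Proof.
apply/ffunP => B; rewrite !ffunE setCK mulrA; congr (_ * _).
rewrite [RHS](bigID [in B]) /=; congr (_ * _).
by apply: eq_bigl => i; rewrite inE.
Qed.

Lemma star_inj (R : comPzRingType) n : injective (@star R n).
Proof.
move=> v w /(congr1 (fun u => (\prod_(i < n) (-1) ^+ i : R) *: star u)).
rewrite !star_star !scalerA -big_split /=.
by rewrite big1 ?scale1r // => i _; rewrite -expr2 sqrr_sign.
Qed.

Lemma star_ehom (R : comPzRingType) n k (w : extalg R n) :
  ehom k w -> ehom (n%:Z - k) (star w).
Proof.
move=> hw B kB; rewrite ffunE hw ?mulr0 //; apply: contra_neq kB => <-.
by have := cardsC B; rewrite card_ord; lia.
Qed.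

Lemma contr1_star (R : comPzRingType) n (f : 'rV[R]_n -> R) (w : extalg R n) :
  contr1 f (star w) = star (wedge1 (\row_i f (delta_mx 0 i)) w).
Proof.
apply/ffunP => B; rewrite contr1E ffunE wedge1E mulr_sumr.
apply: eq_big => [i|i iB]; first by rewrite inE.
(* Both terms read [w] at the complement of [i |: B]; the extra factor (-1)^i from [star] turns the
   sign of [i] in [B] into its sign in the complement. *)
have -> : ~: B :\ i = ~: (i |: B) by apply/setP => j; rewrite !inE negb_or.
rewrite ffunE big_setU1 //= mxE -(pos_sgn_compl R i B) !mulrA.
rewrite -[pos_sgn R i B * _ * pos_sgn R i B]mulrAC pos_sgn_sq mul1r.
by ring.
Qed.

(** * Exactness of the Koszul complex and of its dual *)

Lemma ehom0E (R : comPzRingType) n (w : extalg R n) :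
  ehom 0 w -> w = (w set0 : R) *: ebas R set0.
Proof.
move=> hw; apply/ffunP => A; rewrite !ffunE.
have [->|A0] := eqVneq A set0; first by rewrite /GRing.scale /= mulr1.
by rewrite [w A]hw ?scaler0 //; move: A0; rewrite -cards_eq0; lia.
Qed.

Lemma koszul_exact (R : comPzRingType) n (f : {scalar 'rV[R]_n}) k
    (w : extalg R n) :
  exact_nonzero_degrees (koszul f) -> k != 0 -> ehom k w -> contr1 f w = 0 ->
  exists v, w = contr1 f v.
Proof.
rewrite -[k]opprK oppr_eq0 => hK k0 hw fw.
have [|i [e [y xy]]] := hK (- k) k0 (ext_part (- - k) w).
  by apply: ext_in_inj; rewrite ext_in_kos_d ext_partK // fw linear0.
by exists (ext_in y); rewrite -(ext_partK hw) xy ext_in_kos_d.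
Qed.

(** [star] turns [a] into a Koszul cycle of exterior degree [n - k]. Exactness gives a preimage
    unless [k = n], where the degree is 0 and the last hypothesis supplies one. *)
Lemma wedge1_exact (R : comPzRingType) n (f : {scalar 'rV[R]_n}) k
    (a : extalg R n) :
  exact_nonzero_degrees (koszul f) -> ehom k a ->
  wedge1 (\row_i f (delta_mx 0 i)) a = 0 ->
  (k = n%:Z -> exists v, contr1 f v = (a setT : R) *: ebas R set0) ->
  exists b, a = wedge1 (\row_i f (delta_mx 0 i)) b.
Proof.
move=> hK ha fa atop.
have [v sa] : exists v, star a = contr1 f v.
  have [kn|kn] := eqVneq k n%:Z; last first.
    apply: (koszul_exact hK _ (star_ehom ha)); first by rewrite subr_eq0 eq_sym.
    by rewrite contr1_star fa; apply/ffunP => A; rewrite !ffunE mulr0.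
  have [v va] := atop kn; exists v; rewrite va.
  rewrite [LHS]ehom0E; last by rewrite -(subrr n%:Z) -{2}kn; exact: star_ehom.
  by rewrite ffunE big_set0 mul1r setC0.
(* Since [star] squares to [c] and [c] squares to 1, the inverse of [star] is [c] times [star]. *)
pose c : R := \prod_(i < n) (-1) ^+ i.
exists (c *: star v); apply: star_inj; rewrite -contr1_star sa.
have -> : star (c *: star v) = c *: (c *: v).
  rewrite -[c *: v]star_star; apply/ffunP => A; rewrite !ffunE; exact: mulrCA.
rewrite scalerA -big_split /= big1 ?scale1r // => i _.
by rewrite -expr2 sqrr_sign.
Qed.

(** * Realising linear forms by contractions *)

Lemma iota_seq_coord (R : comPzRingType) n (s : seq 'I_n) (B : {set 'I_n}) :
  uniq s -> {in s, forall i, i \notin B} ->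
  exists e : nat, forall w : extalg R n,
    iota_seq s w B = (-1) ^+ e * w ([set i in s] :|: B).
Proof.
elim: s B => [|i s IH] B /=.
  exists 0%N => w; rewrite mul1r; congr (w _).
  by apply/setP => j; rewrite !inE.
case/andP=> is_ us iB.
have [|e he] := IH (i |: B) us.
  move=> j js; rewrite !inE negb_or iB ?inE ?js ?orbT // andbT.
  by apply: contraNneq is_ => <-.
exists (#|[set j in B | (j < i)%N]| + e)%N => w.
rewrite contr1_eE (negbTE (iB i _)) ?inE ?eqxx // he exprD mulrA.
by congr (_ * w _); apply/setP => j; rewrite !inE; case: eqP => //= ->; rewrite ?orbT.
Qed.

Lemma pairing_contr (R : comPzRingType) n (k : int) (b : extalg R n) :
  exists psi : extpow R n k, forall w, ehom k w ->
    contr (ext_in psi) w set0 = pairing b w.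
Proof.
have H (A : {set 'I_n}) : exists e : nat, forall w : extalg R n,
    iota_seq (enum A) w set0 = (-1) ^+ e * w A.
  have [|e he] := @iota_seq_coord R n (enum A) set0 (enum_uniq _).
    by move=> i _; rewrite inE.
  exists e => w; rewrite he; congr (_ * w _).
  by apply/setP => j; rewrite !inE mem_enum orbF.
pose s A := projT1 (cid (H A)).
(* Twisting [b] by the signs [s] cancels those produced by the contractions; [ext_part] drops the
   components of [b] that pair to zero with degree [k]. *)
exists (ext_part k [ffun A => (-1) ^+ s A * b A]) => w hw.
rewrite contrE sum_ffunE; apply: eq_bigr => A _; rewrite ffunE.
have [kA|kA] := eqVneq #|A|%:Z k; last first.
  by rewrite ext_in_ehom // scale0r hw ?mulr0.
rewrite ffunE insubT ?kA //= => kA'; rewrite !ffunE /= /s; case: cid => e he /=.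
by rewrite he /GRing.scale /= mulrACA -expr2 sqrr_sign mul1r.
Qed.

(* For k < 0 psi is zero, and this says that contr1 f (G w) = 0. *)
Lemma contr1_lift (R : comPzRingType) n (f : {scalar 'rV[R]_n}) (k : int)
    (G : {linear extalg R n -> extalg R n}) :
  exact_nonzero_degrees (koszul f) ->
  (forall w, ehom 1 (G w)) ->
  (forall A : {set 'I_n}, #|A|%:Z != k + 1 -> G (ebas R A) = 0) ->
  (forall w, contr1 f (G (contr1 f w)) = 0) ->
  exists psi : extpow R n k, forall w, ehom (k + 1) w ->
    contr1 f (contr (ext_in psi) w) = contr1 f (G w).
Proof.
move=> hK G1 Gk Gf.
pose a : extalg R n := [ffun A => contr1 f (G (ebas R A)) set0].
have aE w : pairing a w = contr1 f (G w) set0.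
  rewrite [in RHS](extalg_sum w) !linear_sum sum_ffunE.
  by apply: eq_bigr => A _; rewrite !linearZ !ffunE mulrC.
have [||B|b ab] := @wedge1_exact R n f (k + 1) a hK.
- by move=> A kA; rewrite ffunE Gk // linear0 ffunE.
- by apply/ffunP => B; rewrite -pairing_ebas pairing_wedge1 aE Gf !ffunE.
(* In top degree the only coordinate of [a] is f(G(e_1 /\ ... /\ e_n)), visibly in the image of
   [f]. *)
- exists (G (ebas R setT)); rewrite [LHS]ehom0E ?ffunE //.
  exact: contr1_ehom (G1 _).
(* The factor (-1)^k compensates the sign from moving [contr1 f] past the contraction by [psi]. *)
have [psi hpsi] := pairing_contr k (ksgn R k *: b).
exists psi => w hw.
have hfw : ehom k (contr1 f w) by exact: contr1_ehom hw.
rewrite [LHS]ehom0E; last first.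
  apply: (@contr1_ehom _ _ _ 1) => //; apply: contr_ehom hw; last exact: ext_in_ehom.
  by rewrite addrC.
rewrite [RHS]ehom0E; last exact: contr1_ehom (G1 _).
congr (_ *: _); rewrite -aE ab pairing_wedge1 (contr1_contr _ _ (@ext_in_ehom _ _ _ psi)).
rewrite ffunE hpsi // /pairing [LHS]mulr_sumr; apply: eq_bigr => A _.
by rewrite ffunE mulrA [ksgn R k * _]mulrA ksgn_sq mul1r.
Qed.

Lemma ext_part_contr1 (R : comPzRingType) n (g : 'rV[R]_n -> R) (k l : int)
    (w : extalg R n) : l + 1 = k ->
  ext_part l (contr1 g (ext_in (ext_part k w))) = ext_part l (contr1 g w).
Proof.
move=> e; apply/ffunP => -[B Bl]; rewrite !ffunE !contr1E /=.
apply: eq_bigr => i iB; congr (_ * _); rewrite ffunE insubT => [|iBk].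
  by rewrite cardsU1 iB; lia.
by rewrite /= ffunE.
Qed.

(** * Surjectivity in cohomology and the zigzag *)

Definition dgla_id (R : comPzRingType) (L : dgla R) : dgla_mor L L :=
  @DglaMor R L L (fun i => idfun) (fun _ _ _ _ => erefl)
    (fun _ _ _ _ _ _ => erefl).

Theorem theorem2p4 (R : comPzRingType) (n : nat) (f : {scalar 'rV[R]_n})
    (hK : exact_nonzero_degrees (koszul f)) :
  surjective_in_cohomology (i_lt0 f) /\
  numerically_homotopy_abelian (endo_dgla (trunc_lt0 (koszul f))).
Proof.
suff H : surjective_in_cohomology (i_lt0 f).
  (* A single step suffices: the abelian algebra of forms is both [L1] and [L2], with the identity
     as injective leg. *)
  split=> //; apply: (nha_zigzag (g := dgla_id _) H) => //.
  by apply: nha_abelian => i j k e a b.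
pose K := koszul f; pose T := trunc_lt0 K.
move=> k u cu; pose u' : Defs.hom T T k := u.
pose i := - k - 1; have e : i + k = -1 by rewrite /i; lia.
(* The component of [u] into degree -1, extended by zero to the whole exterior algebra. *)
pose G0 w : extalg R n :=
  ext_in (tr_inc K (-1) (u' i (-1) e (tr_proj K i (ext_part (- i) w)))).
have G0_linear : linear G0 by move=> a x y; rewrite /G0 !linearP.
pose G := HB.pack_for {linear extalg R n -> extalg R n} G0
  (GRing.isLinear.Build R _ _ _ G0 G0_linear).
have [|A kA|w|psi hpsi] := @contr1_lift R n f k G hK.
- by move=> w; exact: ext_in_ehom.
- have -> : G (ebas R A) = G 0.
    rewrite /= /G0; congr (ext_in (tr_inc K _ (u' _ _ _ (tr_proj K _ _)))).
    apply/ffunP => -[B Bi]; rewrite !ffunE /=.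
    by case: eqP => // BA; move: kA; rewrite -BA (eqP Bi) /i; lia.
  exact: linear0.
(* As [u] is a cocycle, [G] maps f _| w to a boundary coming from degree -2, which [f] kills. *)
- have e1 : i - 1 + 1 = i by lia.
  have e2 : i - 1 + k = - 2 by lia.
  have e3 : - 2 + 1 = - 1 :> int by [].
  rewrite /= /G0 -(@ext_part_contr1 _ _ _ (- (i - 1))); last by lia.
  set x : K (i - 1) := ext_part _ w.
  have -> : tr_proj K i (ext_part (- i) (contr1 f (ext_in x)))
      = cx_d T e1 (tr_proj K (i - 1) x).
    by rewrite /= tr_incK ?linear0 //; lia.
  have := @endo_cocycleE R T k u _ _ _ _ e2 e3 e1 e (tr_proj K (i - 1) x) cu.
  move/(congr1 (fun z => ksgn R k *: z)).
  rewrite scalerA ksgn_sq scale1r => <-.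
  by rewrite !linearZ /= ext_in_kos_d contr1_sq scaler0.
exists psi; split=> //.
(* [T] lives in degrees [-n] to [-1]. *)
apply: (@endo_coboundary R T k (-1) n).
- by move=> j; apply: tr_projective; exact: ext_projective.
- move=> j x jn; rewrite -[x]tr_projK (_ : tr_inc K j x = 0) ?linear0 //.
  apply/ffunP => -[A Aj]; exfalso; move: (max_card A) Aj; rewrite card_ord; lia.
- move=> j x j1 cx; apply: tr_coboundary; first by lia.
  apply: hK; first by lia.
  by rewrite /cocycle -tr_inc_d ?[cx_d _ _ x]cx ?linear0 //; lia.
- rewrite /cocycle linearB [cx_d _ _ u]cu subr0.
  by rewrite -[LHS](mor_d (i_lt0 f) (erefl (k + 1)) psi) linear0.
- by move=> j l jl x l1; apply: tr_ge0; lia.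
move=> i' e' x; have E : i' = i by rewrite /i; lia.
subst i'; rewrite (eq_irrelevance e' e).
(* In [T] every element of degree -1 is a cocycle, so the cycle condition is checked in [K]: by the
   choice of [psi], the two maps agree after applying [f]. *)
apply: tr_coboundary => //; apply: hK => //.
apply: ext_in_inj; rewrite ext_in_kos_d linear0.
have := hpsi (ext_in (tr_inc K i x)).
rewrite /= /G0 ext_inK => {}hpsi.
rewrite !linearB /= ext_in_kos_i hpsi ?tr_projK ?subrr //.
by rewrite (_ : k + 1 = - i); [exact: ext_in_ehom | rewrite /i; lia].
Qed.
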